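(* Let $H$ be a hereditary subset of the vertex set $E^0$ of a graph $E$ and $K$ a field. Then the ideal $I(H)$ of $L_K(E)$ generated by $H$ is a dense left (respectively, right) ideal of $L_K(E)$ if and only if every vertex of $E^0$ connects to a vertex in $H$.
   Context: A directed graph is $E=(E^0,E^1,r,s)$ with vertex set $E^0$, edge set $E^1$ and range and source maps $r,s:E^1\to E^0$ (arbitrary, not necessarily row-finite). A vertex $v$ is regular if $s^{-1}(v)$ is finite and nonempty. The Leavitt path algebra $L_K(E)$ is the $K$-algebra generated by $E^0\cup E^1\cup\{e^*: e\in E^1\}$ with relations: $vw=\delta_{v,w}v$ for $v,w\in E^0$; $s(e)e=er(e)=e$ and $r(e)e^*=e^*s(e)=e^*$ for $e\in E^1$; $e^*e'=\delta_{e,e'}r(e)$ for $e,e'\in E^1$; and $v=\sum_{s(e)=v}ee^*$ for every regular $v$. A vertex $v$ connects to $w$, written $v\ge w$, if there is a path (possibly of length $0$) from $v$ to $w$. $H\subseteq E^0$ is hereditary if $v\in H$ and $v\ge w$ imply $w\in H$. A right ideal $J$ of a ring $R$ is dense if for all $x,y\in R$ with $x\ne0$ there is $t\in R$ with $xt\neq0$ and $yt\in J$; dense left ideals are defined symmetrically. *)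

(* Defs.v *)
From HB Require Import structures.
From mathcomp Require Import all_boot all_order all_algebra finmap.
From mathcomp Require Import boolp classical_sets functions cardinality.

Set Implicit Arguments.
Unset Strict Implicit.
Unset Printing Implicit Defensive.

Import GRing.Theory.
Local Open Scope classical_set_scope.
Local Open Scope ring_scope.
Local Open Scope quotient_scope.

(* Associative rings and algebras without a unit: [L_K(E)] is unital only
   when [E] has finitely many vertices, so [pzRingType] does not apply. *)

HB.mixin Record Zmodule_isRng R of GRing.Zmodule R := {
  rmul : R -> R -> R;
  rmulA : associative rmul;
  rmulDl : left_distributive rmul +%R;
  rmulDr : right_distributive rmul +%R
}.

#[short(type="rngType")]
HB.structure Definition Rng := {R of Zmodule_isRng R & GRing.Zmodule R}.

Notation "x ** y" := (rmul x y) (at level 40, left associativity) : ring_scope.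

HB.mixin Record Rng_isRngAlgebra (K : pzRingType) A
    of GRing.Lmodule K A & Rng A := {
  rscaleAl : forall (k : K) (x y : A), k *: (x ** y) = (k *: x) ** y;
  rscaleAr : forall (k : K) (x y : A), k *: (x ** y) = x ** (k *: y)
}.

#[short(type="rngAlgType")]
HB.structure Definition RngAlgebra (K : pzRingType) :=
  {A of Rng_isRngAlgebra K A & GRing.Lmodule K A & Rng A}.

Section Ideals.
Variable R : rngType.
Implicit Types I J S : set R.

Definition is_subgroup I : Prop :=
  I 0 /\ forall x y, I x -> I y -> I (x - y).

Definition is_left_ideal I : Prop :=
  is_subgroup I /\ forall r x, I x -> I (r ** x).

Definition is_right_ideal I : Prop :=
  is_subgroup I /\ forall x r, I x -> I (x ** r).

Definition is_ideal I : Prop := is_left_ideal I /\ is_right_ideal I.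

Definition ideal_gen S : set R := smallest is_ideal S.

Definition dense_right_ideal J : Prop :=
  is_right_ideal J /\
  forall x y : R, x <> 0 -> exists t : R, x ** t <> 0 /\ J (y ** t).

Definition dense_left_ideal J : Prop :=
  is_left_ideal J /\
  forall x y : R, x <> 0 -> exists t : R, t ** x <> 0 /\ J (t ** y).

End Ideals.

Record digraph : Type := Digraph {
  vertex : Type;
  edge : Type;
  src : edge -> vertex;
  tgt : edge -> vertex
}.

HB.instance Definition _ (E : digraph) := gen_eqMixin (edge E).
HB.instance Definition _ (E : digraph) := gen_choiceMixin (edge E).

Section Graphs.
Variable E : digraph.

Definition out_edges (v : vertex E) : set (edge E) := [set e | src e = v].

Definition regular (v : vertex E) : Prop :=
  finite_set (out_edges v) /\ out_edges v !=set0.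

Fixpoint is_path (v : vertex E) (p : seq (edge E)) (w : vertex E) : Prop :=
  if p is e :: p' then src e = v /\ is_path (tgt e) p' w else v = w.

Definition connects (v w : vertex E) : Prop := exists p, is_path v p w.

Definition hereditary (H : set (vertex E)) : Prop :=
  forall v w, H v -> connects v w -> H w.

End Graphs.

Section LeavittPathAlgebra.
Variables (K : fieldType) (E : digraph).

(* Formal non-unital [K]-algebra expressions in the generators [v], [e], [e*]. *)
Inductive lpa_term : Type :=
| TVert of vertex E
| TEdge of edge E
| TGhost of edge E
| TZero
| TOpp of lpa_term
| TAdd of lpa_term & lpa_term
| TScale of K & lpa_term
| TMul of lpa_term & lpa_term.

HB.instance Definition _ := gen_eqMixin lpa_term.
HB.instance Definition _ := gen_choiceMixin lpa_term.

Definition TSum (s : seq lpa_term) : lpa_term := foldr TAdd TZero s.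

(* The least congruence containing the axioms of associative [K]-algebras
   and the defining relations of [L_K(E)]. *)
Inductive lpa_rel : lpa_term -> lpa_term -> Prop :=
| rel_refl x : lpa_rel x x
| rel_sym x y : lpa_rel x y -> lpa_rel y x
| rel_trans y x z : lpa_rel x y -> lpa_rel y z -> lpa_rel x z
| rel_opp x x' : lpa_rel x x' -> lpa_rel (TOpp x) (TOpp x')
| rel_add x x' y y' :
    lpa_rel x x' -> lpa_rel y y' -> lpa_rel (TAdd x y) (TAdd x' y')
| rel_scale k x x' : lpa_rel x x' -> lpa_rel (TScale k x) (TScale k x')
| rel_mul x x' y y' :
    lpa_rel x x' -> lpa_rel y y' -> lpa_rel (TMul x y) (TMul x' y')
| rel_addA x y z : lpa_rel (TAdd x (TAdd y z)) (TAdd (TAdd x y) z)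
| rel_addC x y : lpa_rel (TAdd x y) (TAdd y x)
| rel_add0 x : lpa_rel (TAdd TZero x) x
| rel_addN x : lpa_rel (TAdd (TOpp x) x) TZero
| rel_scaleA a b x : lpa_rel (TScale a (TScale b x)) (TScale (a * b) x)
| rel_scale1 x : lpa_rel (TScale 1 x) x
| rel_scaleDr a x y :
    lpa_rel (TScale a (TAdd x y)) (TAdd (TScale a x) (TScale a y))
| rel_scaleDl a b x :
    lpa_rel (TScale (a + b) x) (TAdd (TScale a x) (TScale b x))
| rel_mulA x y z : lpa_rel (TMul x (TMul y z)) (TMul (TMul x y) z)
| rel_mulDl x y z : lpa_rel (TMul (TAdd x y) z) (TAdd (TMul x z) (TMul y z))
| rel_mulDr x y z : lpa_rel (TMul x (TAdd y z)) (TAdd (TMul x y) (TMul x z))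
| rel_scaleAl a x y : lpa_rel (TScale a (TMul x y)) (TMul (TScale a x) y)
| rel_scaleAr a x y : lpa_rel (TScale a (TMul x y)) (TMul x (TScale a y))
| rel_vv v : lpa_rel (TMul (TVert v) (TVert v)) (TVert v)
| rel_vw v w : v <> w -> lpa_rel (TMul (TVert v) (TVert w)) TZero
| rel_se e : lpa_rel (TMul (TVert (src e)) (TEdge e)) (TEdge e)
| rel_er e : lpa_rel (TMul (TEdge e) (TVert (tgt e))) (TEdge e)
| rel_rg e : lpa_rel (TMul (TVert (tgt e)) (TGhost e)) (TGhost e)
| rel_gs e : lpa_rel (TMul (TGhost e) (TVert (src e))) (TGhost e)
| rel_ge e : lpa_rel (TMul (TGhost e) (TEdge e)) (TVert (tgt e))
| rel_gf e f : e <> f -> lpa_rel (TMul (TGhost e) (TEdge f)) TZero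
| rel_ck2 v : regular v ->
    lpa_rel (TVert v)
      (TSum [seq TMul (TEdge e) (TGhost e) | e <- fset_set (out_edges v)]).

Definition lpa_relb (x y : lpa_term) : bool := `[< lpa_rel x y >].

Lemma lpa_relb_refl : reflexive lpa_relb.
Proof. by move=> x; apply/asboolP/rel_refl. Qed.

Lemma lpa_relb_sym : symmetric lpa_relb.
Proof. by move=> x y; apply/asboolP/asboolP; apply: rel_sym. Qed.

Lemma lpa_relb_trans : transitive lpa_relb.
Proof.
by move=> y x z /asboolP xy /asboolP yz; apply/asboolP/(rel_trans xy yz).
Qed.

Canonical lpa_equiv :=
  EquivRel lpa_relb lpa_relb_refl lpa_relb_sym lpa_relb_trans.

Definition lpa : Type := {eq_quot lpa_equiv}.

HB.instance Definition _ := Choice.on lpa.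
HB.instance Definition _ := EqQuotient.on lpa.

Lemma lpa_eqP (x y : lpa_term) : (\pi_lpa x = \pi_lpa y) <-> lpa_rel x y.
Proof.
split=> [/eqP|xy]; first by rewrite eqmodE => /asboolP.
by apply/eqP; rewrite eqmodE; apply/asboolP.
Qed.

Lemma lpa_reprK (x : lpa_term) : lpa_rel (repr (\pi_lpa x)) x.
Proof. by apply/lpa_eqP; rewrite reprK. Qed.

Definition lpa_zero : lpa := \pi_lpa TZero.
Definition lpa_opp : lpa -> lpa := lift_op1 lpa TOpp.
Definition lpa_add : lpa -> lpa -> lpa := lift_op2 lpa TAdd.
Definition lpa_scale (k : K) : lpa -> lpa := lift_op1 lpa (TScale k).
Definition lpa_mul : lpa -> lpa -> lpa := lift_op2 lpa TMul.

Lemma lpa_pi_opp x : lpa_opp (\pi_lpa x) = \pi_lpa (TOpp x).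
Proof. by unlock lpa_opp; apply/lpa_eqP/rel_opp/lpa_reprK. Qed.

Lemma lpa_pi_add x y : lpa_add (\pi_lpa x) (\pi_lpa y) = \pi_lpa (TAdd x y).
Proof. by unlock lpa_add; apply/lpa_eqP/rel_add; apply: lpa_reprK. Qed.

Lemma lpa_pi_scale k x : lpa_scale k (\pi_lpa x) = \pi_lpa (TScale k x).
Proof. by unlock lpa_scale; apply/lpa_eqP/rel_scale/lpa_reprK. Qed.

Lemma lpa_pi_mul x y : lpa_mul (\pi_lpa x) (\pi_lpa y) = \pi_lpa (TMul x y).
Proof. by unlock lpa_mul; apply/lpa_eqP/rel_mul; apply: lpa_reprK. Qed.

Let piE := (lpa_pi_opp, lpa_pi_add, lpa_pi_scale, lpa_pi_mul).

Lemma lpa_addA : associative lpa_add.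
Proof.
elim/quotW=> x; elim/quotW=> y; elim/quotW=> z; rewrite !piE.
exact/lpa_eqP/rel_addA.
Qed.

Lemma lpa_addC : commutative lpa_add.
Proof.
elim/quotW=> x; elim/quotW=> y; rewrite !piE; exact/lpa_eqP/rel_addC.
Qed.

Lemma lpa_add0 : left_id lpa_zero lpa_add.
Proof. elim/quotW=> x; rewrite !piE; exact/lpa_eqP/rel_add0. Qed.

Lemma lpa_addN : left_inverse lpa_zero lpa_opp lpa_add.
Proof. elim/quotW=> x; rewrite !piE; exact/lpa_eqP/rel_addN. Qed.

HB.instance Definition _ :=
  GRing.isZmodule.Build lpa lpa_addA lpa_addC lpa_add0 lpa_addN.

Lemma lpa_mulA : associative lpa_mul.
Proof.
elim/quotW=> x; elim/quotW=> y; elim/quotW=> z; rewrite !piE.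
exact/lpa_eqP/rel_mulA.
Qed.

Lemma lpa_mulDl : left_distributive lpa_mul +%R.
Proof.
elim/quotW=> x; elim/quotW=> y; elim/quotW=> z; rewrite /+%R /= !piE.
exact/lpa_eqP/rel_mulDl.
Qed.

Lemma lpa_mulDr : right_distributive lpa_mul +%R.
Proof.
elim/quotW=> x; elim/quotW=> y; elim/quotW=> z; rewrite /+%R /= !piE.
exact/lpa_eqP/rel_mulDr.
Qed.

HB.instance Definition _ :=
  Zmodule_isRng.Build lpa lpa_mulA lpa_mulDl lpa_mulDr.

Lemma lpa_scaleA a b x : lpa_scale a (lpa_scale b x) = lpa_scale (a * b) x.
Proof. elim/quotW: x => x; rewrite !piE; exact/lpa_eqP/rel_scaleA. Qed.

Lemma lpa_scale1 : left_id 1 lpa_scale.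
Proof. elim/quotW=> x; rewrite !piE; exact/lpa_eqP/rel_scale1. Qed.

Lemma lpa_scaleDr : right_distributive lpa_scale +%R.
Proof.
move=> a; elim/quotW=> x; elim/quotW=> y; rewrite /+%R /= !piE.
exact/lpa_eqP/rel_scaleDr.
Qed.

Lemma lpa_scaleDl x : {morph lpa_scale^~ x : a b / a + b}.
Proof.
move=> a b; elim/quotW: x => x; rewrite [in RHS]/+%R /= !piE.
exact/lpa_eqP/rel_scaleDl.
Qed.

HB.instance Definition _ := GRing.Zmodule_isLmodule.Build K lpa
  lpa_scaleA lpa_scale1 lpa_scaleDr lpa_scaleDl.

Lemma lpa_scaleAl k (x y : lpa) : k *: (x ** y) = (k *: x) ** y.
Proof.
elim/quotW: x => x; elim/quotW: y => y; rewrite /rmul /*:%R /= !piE.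
exact/lpa_eqP/rel_scaleAl.
Qed.

Lemma lpa_scaleAr k (x y : lpa) : k *: (x ** y) = x ** (k *: y).
Proof.
elim/quotW: x => x; elim/quotW: y => y; rewrite /rmul /*:%R /= !piE.
exact/lpa_eqP/rel_scaleAr.
Qed.

HB.instance Definition _ :=
  Rng_isRngAlgebra.Build K lpa lpa_scaleAl lpa_scaleAr.

Definition lpa_vert (v : vertex E) : lpa := \pi_lpa (TVert v).
Definition lpa_edge (e : edge E) : lpa := \pi_lpa (TEdge e).
Definition lpa_ghost (e : edge E) : lpa := \pi_lpa (TGhost e).

Lemma lpa_ck2 (v : vertex E) : regular v ->
  lpa_vert v = \sum_(e <- fset_set (out_edges v)) lpa_edge e ** lpa_ghost e.
Proof.
move=> /rel_ck2 /lpa_eqP; rewrite /lpa_vert => ->.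
elim: (enum_fset _) => [|e s IHs]; first by rewrite big_nil.
by rewrite big_cons -IHs /rmul /= lpa_pi_mul [in RHS]/+%R /= lpa_pi_add.
Qed.

Definition lpa_ideal (H : set (vertex E)) : set lpa :=
  ideal_gen [set lpa_vert v | v in H].

End LeavittPathAlgebra.

Arguments lpa_vert K {E} v.
Arguments lpa_edge K {E} e.
Arguments lpa_ghost K {E} e.
Arguments lpa_ideal K {E} H.

(* Main.v *)
(* The action of L_K(E) on boundary paths, graded by the integers so that cycles
   act without periods, shows that distinct paths are linearly independent;
   hence a nonzero combination a of real paths ending at u stays nonzero when
   multiplied on the right by a path starting at u. Every nonzero x is carried
   to such an a by some path p: strip ghost edges off x on the right while
   x e <> 0 for some edge e; when x kills all edges, a vertex v with x v <> 0 is
   singular by (CK2), and x v is real. If u connects to w in H via q, then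
   x (p q) <> 0 and p q lies in I(H), which is density on the right. Conversely,
   if v connects to no vertex of H then v L_K(E) w = 0 for w in H, so v I(H) = 0,
   which contradicts density at x = y = v. The involution e <-> e^* exchanges
   left and right. *)
Require Import Defs.
From mathcomp Require Import all_boot all_order all_algebra finmap.
From mathcomp Require Import boolp classical_sets functions cardinality.

Set Implicit Arguments.
Unset Strict Implicit.
Unset Printing Implicit Defensive.

Import GRing.Theory Num.Theory.
Local Open Scope ring_scope.
Local Open Scope quotient_scope.

(** * Rings without unit: generated ideals and local units *)

Section RngTheory.
Variable R : rngType.
Implicit Types x y z : R.

Lemma rmul0 x : x ** 0 = 0.
Proof. by apply: (addrI (x ** 0)); rewrite -rmulDr !addr0. Qed.

Lemma r0mul x : 0 ** x = 0.
Proof. by apply: (addrI (0 ** x)); rewrite -rmulDl !addr0. Qed.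

Lemma rmulN x y : x ** - y = - (x ** y).
Proof. by apply: (addrI (x ** y)); rewrite -rmulDr !subrr rmul0. Qed.

Lemma rNmul x y : (- x) ** y = - (x ** y).
Proof. by apply: (addrI (x ** y)); rewrite -rmulDl !subrr r0mul. Qed.

Lemma rmulBl x y z : (x - y) ** z = x ** z - y ** z.
Proof. by rewrite rmulDl rNmul. Qed.

Lemma rmul_sumr I (s : seq I) (P : pred I) (F : I -> R) x :
  x ** (\sum_(i <- s | P i) F i) = \sum_(i <- s | P i) x ** F i.
Proof.
elim/big_rec2: _ => [|i y z _ <-]; first exact: rmul0.
by rewrite rmulDr.
Qed.

Lemma rmul_suml I (s : seq I) (P : pred I) (F : I -> R) x :
  (\sum_(i <- s | P i) F i) ** x = \sum_(i <- s | P i) F i ** x.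
Proof.
elim/big_rec2: _ => [|i y z _ <-]; first exact: r0mul.
by rewrite rmulDl.
Qed.

Lemma ideal_gen_is_ideal (S : set R) : is_ideal (ideal_gen S).
Proof.
split; split; first split.
- by move=> I [[[[]]]].
- move=> x y Sx Sy I IS; case: (IS) => [[[[_ IB]]]] _ _ _.
  by apply: IB; [apply: Sx | apply: Sy].
- by move=> r x Sx I IS; case: (IS) => [[[_ IM]]] _ _; apply: IM; apply: Sx.
- split=> [I [[[[]]]] //|x y Sx Sy I IS]; case: (IS) => [[[[_ IB]]]] _ _ _.
  by apply: IB; [apply: Sx | apply: Sy].
- by move=> x r Sx I IS; case: (IS) => [[_ [_ IM]]] _; apply: IM; apply: Sx.
Qed.

Section OrthogonalIdempotents.
Variables (I : choiceType) (eps : I -> R).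
Hypothesis epsK : forall i, eps i ** eps i = eps i.
Hypothesis eps_ortho : forall i j, i <> j -> eps i ** eps j = 0.

Definition idem_sum (s : {fset I}) : R := \sum_(i <- s) eps i.

Lemma idem_mul_sum s i : i \in s -> eps i ** idem_sum s = eps i.
Proof.
move=> si; rewrite rmul_sumr (big_fsetD1 i) //= epsK.
rewrite big_seq big1 ?addr0 // => j.
rewrite in_fsetD1 => /andP[/eqP ji _]; apply: eps_ortho => ij.
exact: ji.
Qed.

Lemma idem_sum_absorb s t :
  (s `<=` t)%fset -> idem_sum s ** idem_sum t = idem_sum s.
Proof.
move=> /fsubsetP st; rewrite rmul_suml; apply: eq_big_seq => i si.
exact/idem_mul_sum/st.
Qed.

(** A finite sum of orthogonal idempotents acts as a right unit for [x]. The idempotents will be the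
    vertices, and later the elements e e^*. *)
Definition absorbed x := exists s, x ** idem_sum s = x.

Lemma absorbed_idem x i : absorbed (x ** eps i).
Proof.
by exists [fset i]%fset; rewrite -rmulA idem_mul_sum // in_fset1.
Qed.

Lemma absorbed0 : absorbed 0.
Proof. by exists fset0; rewrite r0mul. Qed.

(** The sum over the union of the two supports absorbs each of the smaller sums. *)
Lemma absorbedD x y : absorbed x -> absorbed y -> absorbed (x + y).
Proof.
move=> [s xs] [t yt]; exists (s `|` t)%fset; rewrite rmulDl.
rewrite -{1}xs -{1}yt -!rmulA !idem_sum_absorb ?xs ?yt //.
- exact: fsubsetUr.
- exact: fsubsetUl.
Qed.

End OrthogonalIdempotents.

End RngTheory.

(** * Relations of the Leavitt path algebra and its involution *)

Section LeavittTheory.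
Variables (K : fieldType) (E : digraph).
Local Notation lpa := (lpa K E).
Local Notation term := (lpa_term K E).
Implicit Types (x y z a : lpa) (v w : vertex E) (e f : edge E).
Implicit Types (p q : seq (edge E)).

Local Notation "v %:v" := (lpa_vert K v) (at level 2, format "v %:v").
Local Notation "e %:e" := (lpa_edge K e) (at level 2, format "e %:e").
Local Notation "e ^:*" := (lpa_ghost K e) (at level 2, format "e ^:*").

Lemma lpa_piD (s t : term) : \pi_lpa s + \pi_lpa t = \pi_lpa (TAdd s t).
Proof. exact: lpa_pi_add. Qed.

Lemma lpa_piN (s : term) : - \pi_lpa s = \pi_lpa (TOpp s).
Proof. exact: lpa_pi_opp. Qed.

Lemma lpa_piZ k (s : term) : k *: \pi_lpa s = \pi_lpa (TScale k s).
Proof. exact: lpa_pi_scale. Qed.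

Lemma lpa_piM (s t : term) : \pi_lpa s ** \pi_lpa t = \pi_lpa (TMul s t).
Proof. exact: lpa_pi_mul. Qed.

Lemma lpa_ind (P : lpa -> Prop) :
  (forall v, P v%:v) -> (forall e, P e%:e) -> (forall e, P e^:*) ->
  (forall x y, P x -> P y -> P (x + y)) ->
  (forall (k : K) x, P x -> P (k *: x)) ->
  (forall x y, P x -> P y -> P (x ** y)) ->
  P 0 -> forall x, P x.
Proof.
move=> Pv Pe Pg PD PZ PM P0; elim/quotW; elim=> //.
- by move=> t Pt; rewrite -lpa_piN -scaleN1r; apply: PZ.
- by move=> s Ps t Pt; rewrite -lpa_piD; apply: PD.
- by move=> k t Pt; rewrite -lpa_piZ; apply: PZ.
- by move=> s Ps t Pt; rewrite -lpa_piM; apply: PM.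
Qed.

Lemma vertK v : v%:v ** v%:v = v%:v.
Proof. by rewrite lpa_piM; apply/lpa_eqP/rel_vv. Qed.

Lemma vert_ortho v w : v <> w -> v%:v ** w%:v = 0.
Proof. by move=> vw; rewrite lpa_piM; apply/lpa_eqP/rel_vw. Qed.

Lemma src_edge e : (src e)%:v ** e%:e = e%:e.
Proof. by rewrite lpa_piM; apply/lpa_eqP/rel_se. Qed.

Lemma edge_tgt e : e%:e ** (tgt e)%:v = e%:e.
Proof. by rewrite lpa_piM; apply/lpa_eqP/rel_er. Qed.

Lemma tgt_ghost e : (tgt e)%:v ** e^:* = e^:*.
Proof. by rewrite lpa_piM; apply/lpa_eqP/rel_rg. Qed.

Lemma ghost_src e : e^:* ** (src e)%:v = e^:*.
Proof. by rewrite lpa_piM; apply/lpa_eqP/rel_gs. Qed.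

Lemma ghost_edge e : e^:* ** e%:e = (tgt e)%:v.
Proof. by rewrite lpa_piM; apply/lpa_eqP/rel_ge. Qed.

Lemma ghost_edge_ortho e f : e <> f -> e^:* ** f%:e = 0.
Proof. by move=> ef; rewrite lpa_piM; apply/lpa_eqP/rel_gf. Qed.

Lemma vert_edge_ortho v e : v <> src e -> v%:v ** e%:e = 0.
Proof. by move=> ve; rewrite -src_edge rmulA vert_ortho ?r0mul. Qed.

Lemma edge_vert_ortho e v : tgt e <> v -> e%:e ** v%:v = 0.
Proof. by move=> ve; rewrite -edge_tgt -rmulA vert_ortho ?rmul0. Qed.

Lemma ghost_vert_ortho e v : src e <> v -> e^:* ** v%:v = 0.
Proof. by move=> ve; rewrite -ghost_src -rmulA vert_ortho ?rmul0. Qed.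

Fixpoint star_term (t : term) : term :=
  match t with
  | TVert v => TVert K v
  | TEdge e => TGhost K e
  | TGhost e => TEdge K e
  | TZero => TZero K E
  | TOpp t => TOpp (star_term t)
  | TAdd s t => TAdd (star_term s) (star_term t)
  | TScale k t => TScale k (star_term t)
  | TMul s t => TMul (star_term t) (star_term s)
  end.

Lemma star_termK : involutive star_term.
Proof. by elim=> //= [t ->|s -> t ->|k t ->|s -> t ->]. Qed.

(** Reversal permutes the defining relations: associativity is read backwards, and the source and
    range relations of edges and ghost edges trade places. *)
Lemma star_term_rel (s t : term) :
  lpa_rel s t -> lpa_rel (star_term s) (star_term t).
Proof.
elim=> //=; try by constructor.
- by move=> {s t} s r t _ sr _ rt; apply: rel_trans sr rt.
- by move=> *; apply/rel_sym/rel_mulA.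
- by move=> v w vw; apply: rel_vw => wv; apply: vw.
- by move=> e f ef; apply: rel_gf => fe; apply: ef.
(* Each summand e e^* is its own image, so (CK2) is preserved term by term. *)
- move=> v /rel_ck2 - /(_ K) h; apply: (rel_trans h).
  elim: (enum_fset _) => [|e l IHl] /=; first exact: rel_refl.
  by apply: rel_add => //; apply: rel_refl.
Qed.

Definition star x : lpa := \pi_lpa (star_term (repr x)).

Lemma star_pi (t : term) : star (\pi_lpa t) = \pi_lpa (star_term t).
Proof. exact/lpa_eqP/star_term_rel/lpa_reprK. Qed.

Lemma starK : involutive star.
Proof.
by move=> x; elim/quotW: x => t; rewrite (star_pi t) star_pi star_termK.
Qed.

Lemma starD x y : star (x + y) = star x + star y.
Proof.
elim/quotW: x => s; elim/quotW: y => t.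
by rewrite lpa_piD !star_pi -lpa_piD.
Qed.

Lemma starN x : star (- x) = - star x.
Proof. by elim/quotW: x => s; rewrite lpa_piN !star_pi -lpa_piN. Qed.

Lemma starM x y : star (x ** y) = star y ** star x.
Proof.
elim/quotW: x => s; elim/quotW: y => t.
by rewrite lpa_piM !star_pi -lpa_piM.
Qed.

Lemma star0 : star 0 = 0.
Proof. by rewrite star_pi. Qed.

Lemma star_vert v : star v%:v = v%:v.
Proof. by rewrite star_pi. Qed.

(** The preimage of the ideal under [star] contains [H] and is again an ideal, left and right
    multiples being exchanged. *)
Lemma lpa_ideal_star (H : set (vertex E)) x :
  lpa_ideal K H x -> lpa_ideal K H (star x).
Proof.
have [[[I0 IB] Il] [_ Ir]] := ideal_gen_is_ideal [set v%:v | v in H]%classic.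
move: x; apply: smallest_sub => [|_ [v Hv <-]]; last first.
  by rewrite star_vert => J; case=> _; apply; exists v.
have sub : is_subgroup (fun x => lpa_ideal K H (star x)).
  by rewrite /is_subgroup star0; split=> // x y; rewrite starD starN; apply: IB.
split; split=> // r x Ix; rewrite starM.
- exact: Ir.
- by apply: Il.
Qed.

End LeavittTheory.

(** * Branching systems and the right action they carry *)

Section BranchingSystem.
Variables (K : fieldType) (E : digraph) (V : lmodType K).

(** The laws answer the defining relations: [vdom_inj] the orthogonality of vertices, [pushK] and
    [eran_inj] the values of e^* f, [pullK] and [eran_cover] the relation (CK2). *)
Record branching_system : Type := BranchingSystem {
  bpoint : Type;
  vdom : vertex E -> bpoint -> Prop;
  eran : edge E -> bpoint -> Prop;
  push : edge E -> bpoint -> bpoint;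
  pull : edge E -> bpoint -> bpoint;
  vdom_inj : forall v w x, vdom v x -> vdom w x -> v = w;
  push_ran : forall e x, vdom (tgt e) x -> eran e (push e x);
  pushK : forall e x, vdom (tgt e) x -> pull e (push e x) = x;
  eran_src : forall e x, eran e x -> vdom (src e) x;
  pull_dom : forall e x, eran e x -> vdom (tgt e) (pull e x);
  pullK : forall e x, eran e x -> push e (pull e x) = x;
  eran_inj : forall e f x, eran e x -> eran f x -> e = f;
  eran_cover : forall v x, regular v -> vdom v x -> exists e, eran e x
}.

Variable S : branching_system.
Local Notation X := (bpoint S).

(* The right action of expressions on [V]-valued functions on the branching
   system, dual to the left action on the free module over its points. *)
Fixpoint act_term (t : lpa_term K E) (phi : X -> V) : X -> V :=
  match t with
  | TVert v => fun x => if `[< vdom v x >] then phi x else 0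
  | TEdge e => fun x => if `[< vdom (tgt e) x >] then phi (push e x) else 0
  | TGhost e => fun x => if `[< eran e x >] then phi (pull e x) else 0
  | TZero => fun=> 0
  | TOpp t => fun x => - act_term t phi x
  | TAdd s t => fun x => act_term s phi x + act_term t phi x
  | TScale k t => fun x => k *: act_term t phi x
  | TMul s t => act_term t (act_term s phi)
  end.

(** In a product the right factor acts on the outcome of the left one, so [rel_mulDl] and
    [rel_scaleAl] demand linearity in the function. *)
Lemma act_term_linear t k phi psi x :
  act_term t (fun x => k *: phi x + psi x) x =
  k *: act_term t phi x + act_term t psi x.
Proof.
elim: t phi psi x => [v|e|e||t IH|s IHs t IHt|c t IH|s IHs t IHt] phi psi x /=.
- by case: ifP; rewrite ?scaler0 ?addr0.
- by case: ifP; rewrite ?scaler0 ?addr0.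
- by case: ifP; rewrite ?scaler0 ?addr0.
- by rewrite scaler0 addr0.
- by rewrite IH scalerN opprD.
- by rewrite IHs IHt scalerDr addrACA.
- by rewrite IH scalerDr !scalerA mulrC.
- by rewrite -IHt; congr act_term; apply/funext => y; apply: IHs.
Qed.

Lemma act_termD t phi psi x :
  act_term t (fun x => phi x + psi x) x = act_term t phi x + act_term t psi x.
Proof.
rewrite -[act_term t phi x]scale1r -act_term_linear; congr act_term.
by apply/funext => y; rewrite scale1r.
Qed.

Lemma act_term0 t x : act_term t (fun=> 0) x = 0.
Proof.
have := act_term_linear t 1 (fun=> 0) (fun=> 0) x.
under [fun x : X => _]eq_fun do rewrite scale1r addr0.
by rewrite scale1r -{1}[act_term _ _ _]addr0 => /addrI.
Qed.

Lemma act_termZ t k phi x :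
  act_term t (fun x => k *: phi x) x = k *: act_term t phi x.
Proof.
rewrite -[RHS]addr0 -{1}(act_term0 t x) -act_term_linear; congr act_term.
by apply/funext => y; rewrite addr0.
Qed.

Lemma act_term_sum (s : seq (lpa_term K E)) phi x :
  act_term (TSum s) phi x = \sum_(t <- s) act_term t phi x.
Proof. by elim: s => [|t s IH]; rewrite (big_nil, big_cons) //= IH. Qed.

Lemma act_term_rel s t :
  lpa_rel s t -> forall phi, act_term s phi = act_term t phi.
Proof.
elim=> {s t} //=.
- by move=> r s t _ rs _ st phi; rewrite rs st.
- by move=> s t _ st phi; apply/funext => x; rewrite st.
- by move=> s s' t t' _ ss' _ tt' phi; apply/funext => x; rewrite ss' tt'.
- by move=> k s t _ st phi; apply/funext => x; rewrite st.
- by move=> s s' t t' _ ss' _ tt' phi; rewrite ss' tt'.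
- by move=> r s t phi; apply/funext => x; rewrite addrA.
- by move=> s t phi; apply/funext => x; rewrite addrC.
- by move=> t phi; apply/funext => x; rewrite add0r.
- by move=> t phi; apply/funext => x; rewrite addNr.
- by move=> a b t phi; apply/funext => x; rewrite scalerA.
- by move=> t phi; apply/funext => x; rewrite scale1r.
- by move=> a s t phi; apply/funext => x; rewrite scalerDr.
- by move=> a b t phi; apply/funext => x; rewrite scalerDl.
- by move=> r s t phi; apply/funext => x; rewrite act_termD.
- by move=> k s t phi; apply/funext => x; rewrite act_termZ.
- by move=> v phi; apply/funext => x; case: asboolP.
- move=> v w vw phi; apply/funext => x; case: asboolP => // wx.
  by case: asboolP => // vx; case: vw; apply: vdom_inj vx wx.
- move=> e phi; apply/funext => x; case: asboolP => // ex.
  by rewrite asboolT //; apply/eran_src/push_ran.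
- by move=> e phi; apply/funext => x; case: asboolP.
- move=> e phi; apply/funext => x; case: asboolP => // ex.
  by rewrite asboolT //; apply: pull_dom.
- move=> e phi; apply/funext => x; case: (asboolP (vdom _ _)) => // ex.
  by rewrite asboolF // => /eran_src.
- move=> e phi; apply/funext => x; case: asboolP => // ex.
  by rewrite asboolT ?pushK //; apply: push_ran.
- move=> e f ef phi; apply/funext => x; case: asboolP => // fx.
  by rewrite asboolF // => ex; apply: ef; apply: eran_inj ex (push_ran fx).
- move=> v rv phi; apply/funext => x; rewrite act_term_sum big_map /=.
  have eE e : (if `[< eran e x >] then
       if `[< vdom (tgt e) (pull e x) >] then phi (push e (pull e x)) else 0
     else 0) = if `[< eran e x >] then phi x else 0.
    by case: asboolP => // ex; rewrite asboolT ?pullK //; apply: pull_dom.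
  under eq_bigr do rewrite eE.
  (* At a point of [vdom v] only the edge whose range contains the point contributes; at any other
     point no summand does. *)
  case: asboolP => [vx|nvx].
    have [e ex] := eran_cover rv vx.
    have ve : src e = v by apply: vdom_inj (eran_src ex) vx.
    rewrite (big_fsetD1 e) /=; last by rewrite in_fset_set ?inE //; case: rv.
    rewrite asboolT // big_seq big1 ?addr0 // => f.
    rewrite in_fsetD1 => /andP[/eqP fe _]; rewrite asboolF // => fx.
    by apply: fe; apply: eran_inj fx ex.
  rewrite big_seq big1 // => f.
  rewrite in_fset_set ?inE; last by case: rv.
  move=> /= fv; rewrite asboolF // => fx; apply: nvx; rewrite -fv.
  exact: eran_src.
Qed.

Definition act (a : lpa K E) : (X -> V) -> X -> V := act_term (repr a).

Lemma act_pi (t : lpa_term K E) phi :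
  act (\pi_(lpa K E) t) phi = act_term t phi.
Proof. exact/act_term_rel/lpa_reprK. Qed.

Lemma actD a b phi x : act (a + b) phi x = act a phi x + act b phi x.
Proof.
by elim/quotW: a => s; elim/quotW: b => t; rewrite lpa_piD !act_pi.
Qed.

Lemma actZ k a phi x : act (k *: a) phi x = k *: act a phi x.
Proof. by elim/quotW: a => s; rewrite lpa_piZ !act_pi. Qed.

Lemma act0 phi x : act 0 phi x = 0.
Proof. by rewrite act_pi. Qed.

Lemma actM a b phi : act (a ** b) phi = act b (act a phi).
Proof.
by elim/quotW: a => s; elim/quotW: b => t; rewrite lpa_piM !act_pi.
Qed.

Lemma act_vert v phi x : vdom v x -> act (lpa_vert K v) phi x = phi x.
Proof. by move=> vx; rewrite act_pi /= asboolT. Qed.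

Lemma act_vert_ortho v w phi x :
  vdom v x -> v <> w -> act (lpa_vert K w) phi x = 0.
Proof.
move=> vx vw; rewrite act_pi /= asboolF // => wx.
exact/vw/(vdom_inj vx wx).
Qed.

Lemma act_edge e phi x :
  vdom (tgt e) x -> act (lpa_edge K e) phi x = phi (push e x).
Proof. by move=> ex; rewrite act_pi /= asboolT. Qed.

End BranchingSystem.

(** * The graded branching system of boundary paths *)

Section ReducedPaths.
Variable E : digraph.
Implicit Types (v w : vertex E) (e f : edge E) (p q : seq (edge E)).

(* A chosen edge out of every non-sink; the point [(v, p, n)] of the branching
   system stands for the boundary path that follows [p] and then the chosen
   edges forever, in degree [n]. Hence [p] may not end in a chosen edge, and
   prepending the chosen edge to the empty path does not change the path. *)
Definition chosen e : Prop :=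
  exists h : exists f, `[< src f = src e >], xchoose h = e.

Fixpoint reduced v p : Prop :=
  if p is e :: p' then
    [/\ src e = v, reduced (tgt e) p' & p' = [::] -> ~ chosen e]
  else True.

Definition rpoint : Type := vertex E * seq (edge E) * int.

Definition rdom v (x : rpoint) : Prop := x.1.1 = v /\ reduced v x.1.2.

(** These are the boundary paths with first edge [e]; an empty list at a non-sink starts with the
    chosen edge. *)
Definition rran e (x : rpoint) : Prop :=
  rdom (src e) x /\ (if x.1.2 is f :: _ then f = e else chosen e).

(** The degree grows even when the list stays empty, so a cycle of chosen edges fixes no point. *)
Definition rpush e (x : rpoint) : rpoint :=
  (src e, if (x.1.2 == [::]) && `[< chosen e >] then [::] else e :: x.1.2,
   x.2 + 1).

Definition rpull e (x : rpoint) : rpoint := (tgt e, behead x.1.2, x.2 - 1).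

Lemma chosen_inj e f : src e = src f -> chosen e -> chosen f -> e = f.
Proof.
move=> ef [h he] [h' hf]; apply: etrans (esym he) (etrans _ hf).
by apply: eq_xchoose => g; rewrite ef.
Qed.

Lemma rdom_inj v w x : rdom v x -> rdom w x -> v = w.
Proof. by move=> [<- _] [<-]. Qed.

Lemma rpush_ran e x : rdom (tgt e) x -> rran e (rpush e x).
Proof.
case: x => [[v p] n] [/= ->]; rewrite /rran /rdom /=.
case: p => [|f p] /= r; last by [].
by case: asboolP => /= ce.
Qed.

Lemma rpushK e x : rdom (tgt e) x -> rpull e (rpush e x) = x.
Proof.
case: x => [[v p] n] [/= -> _]; rewrite /rpull /= addrK.
by case: p => [|f p] //=; case: asboolP.
Qed.

Lemma rran_src e x : rran e x -> rdom (src e) x. Proof. by case. Qed.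

Lemma rpull_dom e x : rran e x -> rdom (tgt e) (rpull e x).
Proof.
case: x => [[v [|f p]] n] [[/= -> r]] //= fe; split=> //=.
by case: r; rewrite fe.
Qed.

Lemma rpullK e x : rran e x -> rpush e (rpull e x) = x.
Proof.
case: x => [[v [|f p]] n] [[/= -> r]] /= fe; rewrite /rpush /= subrK.
  by rewrite asboolT.
case: r; rewrite -fe => _ _ nc; case: eqP => //= p0.
by rewrite asboolF //; apply: nc.
Qed.

Lemma rran_inj e f x : rran e x -> rran f x -> e = f.
Proof.
case: x => [[v [|g p]] n] [[/= -> _]] /= ce [[/= ef _]]; last by move=> <-.
exact: chosen_inj.
Qed.

Lemma rran_cover v x : regular v -> rdom v x -> exists e, rran e x.
Proof.
case: x => [[u [|g p]] n] [_ [e0 ve]] [/= -> r].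
  have h : exists f, `[< src f = v >] by exists e0; apply/asboolP.
  have fv : src (xchoose h) = v by apply/asboolP/(xchooseP h).
  exists (xchoose h); split=> /=; first by rewrite fv.
  (* [chosen] speaks of the source of the edge itself, so the choice made for [v] is restated; equal
     predicates have equal choices. *)
  have h' : exists f, `[< src f = src (xchoose h) >].
    by exists (xchoose h); apply/asboolP.
  by exists h'; apply: eq_xchoose => f; rewrite fv.
by exists g; split=> //=; case: r => <-.
Qed.

Definition reduced_system : branching_system E :=
  BranchingSystem rdom_inj rpush_ran rpushK rran_src rpull_dom rpullK rran_inj
    rran_cover.

Definition base v (n : int) : bpoint reduced_system := (v, [::], n).

End ReducedPaths.

(** * Real elements: combinations of paths without ghost edges *)

Section RealElements.
Variables (K : fieldType) (E : digraph).
Local Notation lpa := (lpa K E).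
Implicit Types (x y z a b : lpa) (u v w : vertex E) (e f : edge E).
Implicit Types (p q : seq (edge E)).

Local Notation "v %:v" := (lpa_vert K v) (at level 2, format "v %:v").
Local Notation "e %:e" := (lpa_edge K e) (at level 2, format "e %:e").
Local Notation "e ^:*" := (lpa_ghost K e) (at level 2, format "e ^:*").

(** The end vertex makes the empty path meaningful. The list need not be a path into [w]; a mismatch
    gives 0. *)
Definition lpa_path p w : lpa := foldr (fun e x => e%:e ** x) w%:v p.

Lemma lpa_path_tgt p w : lpa_path p w ** w%:v = lpa_path p w.
Proof. by elim: p => [|e p IHp] /=; rewrite ?vertK // -rmulA IHp. Qed.

Lemma lpa_path_src u p w : is_path u p w -> u%:v ** lpa_path p w = lpa_path p w.
Proof. by case: p => [->|e p [<- _]] /=; rewrite ?vertK // rmulA src_edge. Qed.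

Lemma lpa_path_cat p v q w :
  is_path v q w -> lpa_path p v ** lpa_path q w = lpa_path (p ++ q) w.
Proof.
move=> vqw; elim: p => [|e p IHp] /=; first exact: lpa_path_src.
by rewrite -rmulA IHp.
Qed.

Lemma is_path_cat u p v q w :
  is_path u p v -> is_path v q w -> is_path u (p ++ q) w.
Proof.
by move=> + vqw; elim: p u => [|e p IHp] u /= => [->|[? /IHp]].
Qed.

Inductive real_elt : lpa -> Prop :=
| real0 : real_elt 0
| realD a b : real_elt a -> real_elt b -> real_elt (a + b)
| real_path k u p w : is_path u p w -> real_elt (k *: lpa_path p w).

Lemma real_lpa_path u p w : is_path u p w -> real_elt (lpa_path p w).
Proof.
by move=> upw; rewrite -[lpa_path _ _]scale1r; apply: real_path _ upw.
Qed.

Lemma real_vert v : real_elt v%:v.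
Proof. by rewrite -[v%:v]/(lpa_path [::] v); apply: (@real_lpa_path v). Qed.

Lemma real_edge e : real_elt e%:e.
Proof.
rewrite -edge_tgt -[_ ** _]/(lpa_path [:: e] (tgt e)).
exact: (@real_lpa_path (src e)).
Qed.

Lemma realZ k a : real_elt a -> real_elt (k *: a).
Proof.
elim=> [|b c _ kb _ kc|l u p w upw].
- by rewrite scaler0; apply: real0.
- by rewrite scalerDr; apply: realD.
- by rewrite scalerA; apply: real_path _ upw.
Qed.

Lemma real_mul_vert a v : real_elt a -> real_elt (a ** v%:v).
Proof.
elim=> [|b c _ kb _ kc|l u p w upw].
- by rewrite r0mul; apply: real0.
- by rewrite rmulDl; apply: realD.
- rewrite -rscaleAl -lpa_path_tgt -rmulA.
  have [wv|wv] := pselect (w = v).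
    by rewrite -wv vertK lpa_path_tgt; apply: real_path _ upw.
  by rewrite vert_ortho // rmul0 scaler0; apply: real0.
Qed.

Lemma real_mul_edge a e : real_elt a -> real_elt (a ** e%:e).
Proof.
elim=> [|b c _ kb _ kc|l u p w upw].
- by rewrite r0mul; apply: real0.
- by rewrite rmulDl; apply: realD.
- rewrite -rscaleAl.
  have [we|we] := pselect (w = src e); last first.
    rewrite -lpa_path_tgt -rmulA vert_edge_ortho // rmul0 scaler0.
    exact: real0.
  have eP : is_path w [:: e] (tgt e) by [].
  rewrite -(edge_tgt _ e) -[e%:e ** _]/(lpa_path [:: e] (tgt e)).
  by rewrite (lpa_path_cat _ eP); apply: real_path _ (is_path_cat upw eP).
Qed.

Lemma real_mul_path a p w : real_elt a -> real_elt (a ** lpa_path p w).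
Proof.
elim: p a => [|e p IHp] a ra /=; first exact: real_mul_vert.
by rewrite rmulA; apply/IHp/real_mul_edge.
Qed.

Section Action.
Variables (V : lmodType K) (S : branching_system E).

Lemma vdom_path u p v (x : bpoint S) :
  is_path u p v -> vdom v x -> vdom u (foldr (@push E S) x p).
Proof.
move=> + vx; elim: p u => [|e p IHp] u /= => [->//|[<- /IHp]].
by move=> /push_ran/eran_src.
Qed.

Lemma act_path u p v (phi : bpoint S -> V) (x : bpoint S) :
  is_path u p v -> vdom v x ->
  act (lpa_path p v) phi x = phi (foldr (@push E S) x p).
Proof.
move=> + vx; elim: p u phi => [|e p IHp] u phi /=; first by rewrite act_vert.
move=> [_ tp]; rewrite actM (IHp _ _ tp) act_edge //.
exact: vdom_path tp vx.
Qed.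

End Action.

(** * Independence of paths and right cancellation of edges *)

Lemma vert_neq0 v : v%:v <> 0.
Proof.
move=> v0; have vx : rdom v (base v 0) by [].
have := act_vert (V := K^o) (fun=> 1) (vx : vdom (b := reduced_system E) v _).
by rewrite v0 act0 => /eqP; rewrite eq_sym oner_eq0.
Qed.

Local Notation rpt := (bpoint (reduced_system E)).
Local Notation rpushes := (foldr (@push E (reduced_system E))).

Lemma rpushes_deg p (x : rpt) : (rpushes x p).2 = x.2 + (size p)%:R.
Proof.
elim: p => [|e p IHp] /=; first by rewrite addr0.
by rewrite /push /= IHp -addrA natr1.
Qed.

(** The degree forces equal lengths; disjointness of the edge ranges then identifies the edges one
    at a time. *)
Lemma rpushes_inj u p u' q v (x : rpt) : vdom v x -> is_path u p v ->
  is_path u' q v -> rpushes x p = rpushes x q -> p = q.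
Proof.
move=> vx pP qP pq.
have : size p = size q.
  have := congr1 snd pq; rewrite !rpushes_deg => /addrI/eqP.
  by rewrite eqr_nat => /eqP.
elim: p u u' q pP qP pq => [|e p IHp] u u' [|f q] //=.
move=> [_ pP] [_ qP] pq [spq].
have {}pq : push e (rpushes x p) = push f (rpushes x q) := pq.
have pe := vdom_path pP vx; have qf := vdom_path qP vx.
have ef : e = f.
  by apply: eran_inj (push_ran pe) _; rewrite pq; apply: push_ran.
rewrite -{}ef in qP qf pq *; congr cons; apply: IHp pP qP _ spq.
by rewrite -(pushK pe) pq pushK.
Qed.

(* Distinct paths push [x] to distinct points, so this function labels each
   point reached from [x] by the path used, and evaluating its translate by [a]
   at [x] reads [a] off. *)
Definition path_of v (x : rpt) : rpt -> lpa := fun y : rpt =>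
  if pselect (exists p, (exists u, is_path u p v) /\ rpushes x p = y) is left h
  then lpa_path (sval (cid h)) v else 0.

(** The functions take values in the algebra itself, so evaluation returns an element rather than a
    family of coefficients. *)
Lemma act_path_of v (x : rpt) a :
  vdom v x -> real_elt a -> act a (path_of v x) x = a ** v%:v.
Proof.
move=> vx; elim=> [|b c _ IHb _ IHc|k u p w upw].
- by rewrite act0 r0mul.
- by rewrite actD rmulDl IHb IHc.
- rewrite actZ -rscaleAl; congr (_ *: _).
  have [wv|wv] := pselect (w = v); last first.
    rewrite -lpa_path_tgt -rmulA vert_ortho // rmul0 actM.
    by rewrite (act_vert_ortho _ vx) // => /esym.
  rewrite {w}wv in upw *; rewrite lpa_path_tgt (act_path _ upw) // /path_of.
  case: pselect => [h|[]]; last by exists p; split=> //; exists u.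
  have [[u' qP] pq] := svalP (cid h).
  by rewrite (rpushes_inj vx qP upw pq).
Qed.

(** Acting by [a] and evaluating at the push of a point along [e] is the same as acting by a e and
    evaluating at the point. *)
Lemma real_mul_edge_eq0 a e :
  real_elt a -> a ** e%:e = 0 -> a ** (src e)%:v = 0.
Proof.
move=> ra ae; have ex : vdom (tgt e) (base (tgt e) 0) by [].
have sx := eran_src (push_ran ex).
by rewrite -(act_path_of sx ra) -(act_edge _ ex) -actM ae act0.
Qed.

Lemma real_mul_path_neq0 a v p w : real_elt a -> is_path v p w ->
  a ** v%:v <> 0 -> a ** lpa_path p w <> 0.
Proof.
elim: p v a => [|e p IHp] v a ra /= => [->//|[<- tpw] av].
rewrite rmulA; apply: IHp tpw _; first exact: real_mul_edge.
by rewrite -rmulA edge_tgt => /(real_mul_edge_eq0 ra).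
Qed.

(** * Normal form with ghost edges on the right, and reduction to real elements *)

Inductive lpa_span : lpa -> Prop :=
| span_real a : real_elt a -> lpa_span a
| spanD x y : lpa_span x -> lpa_span y -> lpa_span (x + y)
| span_ghost x e : lpa_span x -> lpa_span (x ** e^:*).

Lemma spanZ k x : lpa_span x -> lpa_span (k *: x).
Proof.
elim=> [a ra|y z _ Sy _ Sz|y e _ Sy].
- exact/span_real/realZ.
- by rewrite scalerDr; apply: spanD.
- by rewrite rscaleAl; apply: span_ghost.
Qed.

Lemma span0 : lpa_span 0. Proof. exact/span_real/real0. Qed.

Lemma span_mul_vert x v : lpa_span x -> lpa_span (x ** v%:v).
Proof.
elim=> [a ra|y z _ Sy _ Sz|y e Sy _].
- exact/span_real/real_mul_vert.
- by rewrite rmulDl; apply: spanD.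
- rewrite -rmulA; have [<-|ev] := pselect (src e = v).
    by rewrite ghost_src; apply: span_ghost.
  by rewrite ghost_vert_ortho // rmul0; apply: span0.
Qed.

Lemma span_mul_edge x e : lpa_span x -> lpa_span (x ** e%:e).
Proof.
elim=> [a ra|y z _ Sy _ Sz|y f Sy _].
- exact/span_real/real_mul_edge.
- by rewrite rmulDl; apply: spanD.
- rewrite -rmulA; have [<-|fe] := pselect (f = e).
    by rewrite ghost_edge; apply: span_mul_vert.
  by rewrite ghost_edge_ortho // rmul0; apply: span0.
Qed.

(** Induction on the right factor, for all [x], leaves only multiplication by a generator; an edge
    meeting a trailing ghost edge cancels it or gives 0. *)
Lemma span_mul x y : lpa_span x -> lpa_span (x ** y).
Proof.
elim/lpa_ind: y x => [v|e|e|y z IHy IHz|k y IHy|y z IHy IHz|] x Sx.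
- exact: span_mul_vert.
- exact: span_mul_edge.
- exact: span_ghost.
- by rewrite rmulDr; apply: spanD; [apply: IHy | apply: IHz].
- by rewrite -rscaleAr; apply/spanZ/IHy.
- by rewrite rmulA; apply/IHz/IHy.
- by rewrite rmul0; apply: span0.
Qed.

Lemma lpa_spanT x : lpa_span x.
Proof.
elim/lpa_ind: x => [v|e|e|y z|k y|y z Sy _|].
- exact/span_real/real_vert.
- exact/span_real/real_edge.
- by rewrite -tgt_ghost; apply/span_ghost/span_real/real_vert.
- exact: spanD.
- exact: spanZ.
- exact: span_mul.
- exact: span0.
Qed.

(** The bound counts trailing ghost edges: each is consumed by one edge of a path multiplied on the
    right. *)
Lemma eventually_real x : exists n, forall p w,
  (n <= size p)%N -> real_elt (x ** lpa_path p w).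
Proof.
elim: (lpa_spanT x) => [a ra|y z _ [n ny] _ [m mz]|y e _ [n ny]].
- by exists 0%N => p w _; apply: real_mul_path.
- exists (maxn n m) => p w; rewrite geq_max => /andP[np mp].
  by rewrite rmulDl; apply: realD; [apply: ny | apply: mz].
- exists n.+1 => -[|f p] w //= np; rewrite -rmulA [X in y ** X]rmulA.
  have [<-|ef] := pselect (e = f); last first.
    by rewrite ghost_edge_ortho // r0mul rmul0; apply: real0.
  (* The bound concerns arbitrary lists, so those that are not paths from the range of [e] are shown
     to give 0. *)
  rewrite ghost_edge; have [tp|tp] := pselect (is_path (tgt e) p w).
    by rewrite lpa_path_src //; apply: ny.
  suff -> : (tgt e)%:v ** lpa_path p w = 0 by rewrite rmul0; apply: real0.
  elim: p (tgt e) {np} tp => [|g p IHp] v /= vp; first exact: vert_ortho.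
  have [vg|vg] := pselect (src g = v); last first.
    by rewrite rmulA vert_edge_ortho ?r0mul // => /esym.
  rewrite -vg rmulA src_edge -edge_tgt -rmulA IHp ?rmul0 // => gp.
  exact: vp.
Qed.

Lemma edge_idem e : e%:e ** e^:* ** (e%:e ** e^:*) = e%:e ** e^:*.
Proof. by rewrite -rmulA [X in e%:e ** X]rmulA ghost_edge tgt_ghost. Qed.

Lemma edge_idem_ortho e f :
  e <> f -> e%:e ** e^:* ** (f%:e ** f^:*) = 0.
Proof.
by move=> ef; rewrite -rmulA [X in _ ** X]rmulA ghost_edge_ortho // r0mul rmul0.
Qed.

Lemma edge_idem_vert e : e%:e ** e^:* ** (src e)%:v = e%:e ** e^:*.
Proof. by rewrite -rmulA ghost_src. Qed.

Lemma edge_idem_vert_ortho e v : src e <> v -> e%:e ** e^:* ** v%:v = 0.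
Proof. by move=> ev; rewrite -rmulA ghost_vert_ortho // rmul0. Qed.

(** Since e^* e e^* = e^*, every term that ends in a ghost edge is absorbed. *)
Lemma real_decomposition x : exists a, real_elt a /\
  absorbed (fun e => e%:e ** e^:*) (x - a).
Proof.
elim: (lpa_spanT x) => [a ra|y z _ [a [ra ya]] _ [b [rb zb]]|y e _ _].
- by exists a; split=> //; rewrite subrr; apply: absorbed0.
- exists (a + b); split; first exact: realD.
  rewrite opprD addrACA; apply: absorbedD => //.
  + exact: edge_idem.
  + exact: edge_idem_ortho.
- exists 0; split; first exact: real0.
  rewrite subr0; exists [fset e]%fset.
  rewrite /idem_sum big_seq_fset1 -rmulA [X in y ** X]rmulA ghost_edge.
  by rewrite tgt_ghost.
Qed.

Lemma mul_vert_eq0 x : (forall v, x ** v%:v = 0) -> x = 0.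
Proof.
(* Finite sets of vertices require a choice structure, supplied classically. *)
pose eps (v : {classic vertex E}) := (v : vertex E)%:v.
have [s xs] : absorbed eps x.
  have epsK (i : {classic vertex E}) : eps i ** eps i = eps i by apply: vertK.
  have epsO (i j : {classic vertex E}) : i <> j -> eps i ** eps j = 0.
    exact: vert_ortho.
  elim: (lpa_spanT x) => [a|y z _ ys _ zs|y e _ _].
  - elim=> [|b c _ bs _ cs|k u p w _]; first exact: absorbed0.
      exact: absorbedD.
    rewrite -lpa_path_tgt rscaleAl.
    exact: (absorbed_idem epsK epsO _ (w : {classic vertex E})).
  - exact: absorbedD.
  - rewrite -ghost_src rmulA.
    exact: (absorbed_idem epsK epsO _ (src e : {classic vertex E})).
move=> x0; rewrite -xs rmul_sumr big1 // => v _; exact: x0.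
Qed.

Lemma neq0_mul_vert x : x <> 0 -> exists v, x ** v%:v <> 0.
Proof.
move=> x0; apply: contrapT => nv; apply: x0; apply: mul_vert_eq0 => v.
by apply: contrapT => xv; apply: nv; exists v.
Qed.

Lemma mul_vert_regular_eq0 x v :
  regular v -> (forall e, x ** e%:e = 0) -> x ** v%:v = 0.
Proof.
move=> rv xe; rewrite lpa_ck2 // rmul_sumr big1 // => e _.
by rewrite rmulA xe r0mul.
Qed.

(** As [x] kills edges, x = a - a d with [a] real and d a finite sum of e e^*. It turns out that [v]
    must be a sink, where d v = 0 and x v = a v. *)
Lemma mul_vert_killed_real x v :
  (forall e, x ** e%:e = 0) -> x ** v%:v <> 0 -> real_elt (x ** v%:v).
Proof.
move=> xe xv; have [a [ra [s xas]]] := real_decomposition x.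
have xs0 : x ** idem_sum (fun e => e%:e ** e^:*) s = 0.
  by rewrite rmul_sumr big1 // => e _; rewrite rmulA xe r0mul.
have {xas}xE : x = a - a ** idem_sum (fun e => e%:e ** e^:*) s.
  by move: xas; rewrite rmulBl xs0 sub0r => ->; rewrite addrC subrK.
(* If [v] emits an edge [f] outside [s], then d f = 0 and a f = x f = 0. Cancelling [f] gives a v =
   0, hence x v = 0, a contradiction. *)
have [[f [sf fs]]|sub] := pselect (exists f, src f = v /\ f \notin s).
  have af : a ** f%:e = 0.
    rewrite -(xe f) xE rmulBl -[X in _ - X]rmulA rmul_suml.
    rewrite big_seq big1 ?rmul0 ?subr0 // => e es.
    rewrite -rmulA ghost_edge_ortho ?rmul0 // => ef.
    by rewrite ef in es; rewrite es in fs.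
  have av : a ** v%:v = 0 by rewrite -sf; apply: real_mul_edge_eq0.
  case: xv; rewrite xE rmulBl av sub0r -rmulA rmul_suml rmul_sumr.
  rewrite big1 ?oppr0 // => e _.
  have [ev|ev] := pselect (src e = v).
    by rewrite -{1}ev edge_idem_vert -src_edge ev !rmulA av !r0mul.
  by rewrite edge_idem_vert_ortho ?rmul0.
have fin : finite_set (out_edges v).
  apply: (@sub_finite_set _ _ [set` s]); last exact: finite_fset.
  move=> f fv /=; apply: contrapT => /negP fs; apply: sub; exists f.
  by split.
(* All edges out of [v] lie in [s]; if there were one, [v] would be regular and (CK2) would give x v
   = 0. *)
have [ne|em] := pselect (out_edges v !=set0)%classic.
  by case: xv; apply: mul_vert_regular_eq0.
suff -> : x ** v%:v = a ** v%:v by apply: real_mul_vert.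
rewrite xE rmulBl -[X in _ - X]rmulA rmul_suml big1 ?rmul0 ?subr0 // => e _.
by apply: edge_idem_vert_ortho => ev; apply: em; exists e.
Qed.

Lemma real_reduction x : x <> 0 -> exists p w,
  real_elt (x ** lpa_path p w) /\ x ** lpa_path p w <> 0.
Proof.
have [n] := eventually_real x.
elim: n x => [|n IHn] x rx x0; have [v xv] := neq0_mul_vert x0.
  by exists [::], v; split=> //; apply: rx.
(* Passing from [x] to x e lowers the length bound by one. *)
have [[e xe]|nxe] := pselect (exists e, x ** e%:e <> 0).
  have [|p [w]] := IHn (x ** e%:e) _ xe.
    by move=> p w np; rewrite -rmulA; apply: (rx (e :: p)).
  by rewrite -rmulA; exists (e :: p), w.
exists [::], v; split=> //; apply: mul_vert_killed_real => // e.
by apply: contrapT => xe; apply: nxe; exists e.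
Qed.

(** * Density of the ideal of a hereditary set *)

Section HereditarySet.
Variable H : set (vertex E).

Lemma lpa_ideal_vert v : H v -> lpa_ideal K H v%:v.
Proof. by move=> Hv; apply: sub_gen_smallest; exists v. Qed.

(** The witness lies in the ideal itself, so y t does too for every y. *)
Lemma connects_ideal_mul x : (forall v, exists w, H w /\ connects v w) ->
  x <> 0 -> exists t, x ** t <> 0 /\ lpa_ideal K H t.
Proof.
move=> Hc /real_reduction[p [v [rx x0]]].
have [w [Hw [q vqw]]] := Hc v.
have [[_ Il] _] := ideal_gen_is_ideal [set v%:v | v in H]%classic.
exists (lpa_path p v ** lpa_path q w); split.
  rewrite rmulA; apply: (real_mul_path_neq0 rx vqw).
  by rewrite -rmulA lpa_path_tgt.
by rewrite -(lpa_path_tgt q) rmulA; apply: Il; apply: lpa_ideal_vert.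
Qed.

Hypothesis hH : hereditary H.

(** Moving past a trailing ghost edge replaces [w] by the range of an edge leaving [w], which stays
    in [H] by heredity. A nonzero real term would contain a path from [v] to [w]. *)
Lemma not_connects_mul v : (forall w, H w -> ~ connects v w) ->
  forall x w, H w -> v%:v ** x ** w%:v = 0.
Proof.
move=> nv x; elim: (lpa_spanT x) => [a ra|y z _ IHy _ IHz|y e _ IHy] w Hw.
- elim: ra => [|b c _ IHb _ IHc|k u p w' uP].
  + by rewrite rmul0 r0mul.
  + by rewrite rmulDr rmulDl IHb IHc addr0.
  rewrite -rscaleAr -rscaleAl -lpa_path_tgt -(lpa_path_src uP).
  have [vu|vu] := pselect (v = u); last first.
    by rewrite !rmulA vert_ortho // !r0mul scaler0.
  have [ww|ww] := pselect (w' = w); last first.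
    by rewrite -!rmulA vert_ortho // !rmul0 scaler0.
  by case: (nv w Hw); exists p; rewrite vu -ww.
- by rewrite rmulDr rmulDl IHy // IHz // addr0.
- have [ew|ew] := pselect (src e = w); last first.
    by rewrite -!rmulA ghost_vert_ortho // !rmul0.
  rewrite -tgt_ghost !rmulA IHy ?r0mul //.
  by apply: (hH Hw); exists [:: e].
Qed.

Lemma not_connects_ideal v : (forall w, H w -> ~ connects v w) ->
  forall x, lpa_ideal K H x -> v%:v ** x = 0.
Proof.
(* With [r] quantified, the condition on [x] is stable under left multiplication and so defines a
   two-sided ideal. *)
move=> nv x Ix; suff : forall r, v%:v ** r ** x = 0.
  by move=> /(_ v%:v); rewrite vertK.
move: x Ix; apply: smallest_sub => [|_ [w Hw <-] r]; last first.
  exact: not_connects_mul.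
have sub : is_subgroup (fun x => forall r, v%:v ** r ** x = 0).
  split=> [r|x y x0 y0 r]; first by rewrite rmul0.
  by rewrite rmulDr rmulN x0 y0 subr0.
split; split=> //=.
- by move=> s x x0 r; rewrite rmulA -(rmulA _ r s) x0.
- by move=> x s x0 r; rewrite rmulA x0 r0mul.
Qed.

Lemma dense_right_lpa_ideal : dense_right_ideal (lpa_ideal K H) <->
  forall v, exists w, H w /\ connects v w.
Proof.
have [[_ Il] Ir] := ideal_gen_is_ideal [set v%:v | v in H]%classic.
split=> [[_ dI] v|Hc].
  apply: contrapT => nw.
  have nv w : H w -> ~ connects v w by move=> Hw vw; apply: nw; exists w.
  have [t [vt0 /(not_connects_ideal nv)]] := dI v%:v v%:v (@vert_neq0 v).
  by rewrite rmulA vertK.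
split=> // x y /(connects_ideal_mul Hc)[t [xt0 It]].
by exists t; split=> //; apply: Il.
Qed.

(** The involution is injective, reverses products and preserves the ideal, so it carries a witness
    for the starred pair to one on the other side. *)
Lemma dense_left_right_lpa_ideal :
  dense_left_ideal (lpa_ideal K H) <-> dense_right_ideal (lpa_ideal K H).
Proof.
have [Il Ir] := ideal_gen_is_ideal [set v%:v | v in H]%classic.
have star_neq0 x : x <> 0 -> star x <> 0.
  by move=> x0 sx0; apply: x0; rewrite -[x]starK sx0 star0.
split=> -[_ dI]; split=> // x y x0.
- have [t [tx It]] := dI (star x) (star y) (star_neq0 _ x0).
  exists (star t); rewrite -{1}(starK x) -{1}(starK y) -!starM; split.
    exact: star_neq0.
  exact: lpa_ideal_star.
- have [t [tx It]] := dI (star x) (star y) (star_neq0 _ x0).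
  exists (star t); rewrite -{1}(starK x) -{1}(starK y) -!starM; split.
    exact: star_neq0.
  exact: lpa_ideal_star.
Qed.

End HereditarySet.

End RealElements.

Theorem proposition1p10 (K : fieldType) (E : digraph) (H : set (vertex E))
    (hH : hereditary H) :
  (dense_left_ideal (lpa_ideal K H) <->
     forall v : vertex E, exists w : vertex E, H w /\ connects v w) /\
  (dense_right_ideal (lpa_ideal K H) <->
     forall v : vertex E, exists w : vertex E, H w /\ connects v w).
Proof.
have dr := dense_right_lpa_ideal K hH.
by split=> //; rewrite dense_left_right_lpa_ideal.
Qed.
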